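(* Let $\mathrm{Rec}$ be the model over $\mathbb N$ consisting of all total recursive functions $\mathbb N\to\mathbb N$, and let $\mathrm{Prim}$ be the model over $\mathbb N$ consisting of all primitive recursive functions $\mathbb N\to\mathbb N$. Then $\mathrm{Rec}\succ\mathrm{Prim}$; that is, $\mathrm{Rec}\succsim\mathrm{Prim}$, but there is no injection $\rho:\mathbb N\to\mathbb N$ with $\mathrm{Prim}\succsim_\rho\mathrm{Rec}$.
   Context: A model of computation over a set $D$ is any set of functions $f:D\to D\cup\{\bot\}$, where $\bot$ denotes ''undefined''; $\mathrm{dom}\,A$ denotes the domain of a model $A$. An encoding is an injection $\rho:\mathrm{dom}\,B\to\mathrm{dom}\,A$, extended by $\rho(\bot)=\bot$. Model $A$ simulates model $B$ via $\rho$, written $A\succsim_\rho B$, if for every $g\in B$ there is $f\in A$ with $\rho\circ g=f\circ\rho$ (as functions on $\mathrm{dom}\,B$). $A\succsim B$ means $A\succsim_\rho B$ for some injection $\rho$; $A\succ B$ means $A\succsim B$ and not $B\succsim A$. *)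

(* Defs.v *)
From mathcomp Require Import all_boot.

Set Implicit Arguments.
Unset Strict Implicit.
Unset Printing Implicit Defensive.

(* A model over D is a set of functions D -> D + {bot}; None stands for bot. *)
Definition model (D : Type) : Type := (D -> option D) -> Prop.

(* rho \o g = f \o rho on D_B, where omap is the extension rho(bot) = bot. *)
Definition simulates_via (DA DB : Type) (A : model DA) (rho : DB -> DA)
    (B : model DB) : Prop :=
  forall g, B g -> exists2 f, A f & forall x, omap rho (g x) = f (rho x).

Definition simulates (DA DB : Type) (A : model DA) (B : model DB) : Prop :=
  exists2 rho : DB -> DA, injective rho & simulates_via A rho B.

Definition strictly_simulates (DA DB : Type) (A : model DA) (B : model DB) :
    Prop :=
  simulates A B /\ ~ simulates B A.

(* Primitive recursive schemes of arity n. Recursion is on the first argument: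
   h(0, x) = f(x),  h(k + 1, x) = g(k, h(k, x), x). *)
Inductive prim_scheme : nat -> Type :=
| PZero n : prim_scheme n
| PSucc : prim_scheme 1
| PProj n (i : 'I_n) : prim_scheme n
| PComp m n (f : prim_scheme m) (gs : 'I_m -> prim_scheme n) : prim_scheme n
| PRec n (f : prim_scheme n) (g : prim_scheme n.+2) : prim_scheme n.+1.

Fixpoint prim_eval n (c : prim_scheme n) : n.-tuple nat -> nat :=
  match c in prim_scheme n return n.-tuple nat -> nat with
  | PZero _ => fun _ => 0
  | PSucc => fun v => (thead v).+1
  | PProj _ i => fun v => tnth v i
  | PComp _ _ f gs => fun v => prim_eval f [tuple prim_eval (gs i) v | i < _]
  | PRec _ f g => fun v =>
      let x := [tuple of behead v] in
      (fix h k := if k is k'.+1 then prim_eval g [tuple of k' :: h k' :: x]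
                  else prim_eval f x) (thead v)
  end.

Definition primitive_recursive (h : nat -> nat) : Prop :=
  exists c : prim_scheme 1, forall x, prim_eval c [tuple x] = h x.

(* Schemes for partial recursive functions: the above plus unbounded
   minimization  mu y. f(y, x) = 0. *)
Inductive rec_scheme : nat -> Type :=
| RZero n : rec_scheme n
| RSucc : rec_scheme 1
| RProj n (i : 'I_n) : rec_scheme n
| RComp m n (f : rec_scheme m) (gs : 'I_m -> rec_scheme n) : rec_scheme n
| RRec n (f : rec_scheme n) (g : rec_scheme n.+2) : rec_scheme n.+1
| RMin n (f : rec_scheme n.+1) : rec_scheme n.

(* rec_graph c v y: the partial function denoted by c is defined at v with
   value y. Every intermediate value must be defined; in particular, for
   minimization, f(z, x) must be defined and nonzero for all z < y. *)
Fixpoint rec_graph n (c : rec_scheme n) : n.-tuple nat -> nat -> Prop :=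
  match c in rec_scheme n return n.-tuple nat -> nat -> Prop with
  | RZero _ => fun _ y => y = 0
  | RSucc => fun v y => y = (thead v).+1
  | RProj _ i => fun v y => y = tnth v i
  | RComp m _ f gs => fun v y =>
      exists2 w : m.-tuple nat,
        forall i, rec_graph (gs i) v (tnth w i) & rec_graph f w y
  | RRec _ f g => fun v y =>
      let x := [tuple of behead v] in
      (fix h k y :=
         if k is k'.+1 then
           exists2 r, h k' r & rec_graph g [tuple of k' :: r :: x] y
         else rec_graph f x y) (thead v) y
  | RMin _ f => fun v y =>
      rec_graph f [tuple of y :: v] 0 /\
      forall z, z < y -> exists r, rec_graph f [tuple of z :: v] r.+1
  end.

Definition total_recursive (h : nat -> nat) : Prop :=
  exists c : rec_scheme 1, forall x y, rec_graph c [tuple x] y <-> y = h x.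

Definition Prim : model nat := fun f =>
  exists2 h, primitive_recursive h & forall x, f x = Some (h x).

Definition Rec : model nat := fun f =>
  exists2 h, total_recursive h & forall x, f x = Some (h x).

(* Main.v *)
Require Import Defs.
From mathcomp Require Import all_boot.

(** If Prim simulates Rec via rho, then simulating the successor gives a
   primitive recursive f with rho (n + 1) = f (rho n), so rho itself is
   primitive recursive; hence rho \o g is primitive recursive for every total
   recursive g.  As rho is injective, it is unbounded, so for any total
   recursive A the function g x = min {y | rho y >= A x} is total recursive, and rho \o g
   dominates A.  This is absurd when A grows faster than all primitive recursive
   functions.

   For A we take the diagonal of a fast-growing hierarchy E.  Its recursiveness
   needs no pairing: E m t is the time at which a process, started at time t on
   a stack with top m, first uncovers the rest of the stack, where one unit of
   time replaces the top m by a number of copies of m - 1 depending on the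
   current time.  Stacks are coded as numbers, so the process is a primitive
   recursion on time followed by one minimization. *)

Set Implicit Arguments.
Unset Strict Implicit.
Unset Printing Implicit Defensive.

(** * Closure properties of recursive functions *)

Definition computable n (F : n.-tuple nat -> nat) : Prop :=
  exists c : rec_scheme n, forall v y, rec_graph c v y <-> y = F v.

Lemma eq_computable n (F G : n.-tuple nat -> nat) :
  F =1 G -> computable F -> computable G.
Proof. by move=> eqFG [c cP]; exists c => v y; rewrite -eqFG. Qed.

Lemma computable_zero n : computable (fun _ : n.-tuple nat => 0).
Proof. by exists (RZero n). Qed.

Lemma computable_proj n (i : 'I_n) : computable (fun v => tnth v i).
Proof. by exists (RProj i). Qed.

Lemma computable_comp m n (F : m.-tuple nat -> nat)
    (G : 'I_m -> n.-tuple nat -> nat) :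
  computable F -> (forall i, computable (G i)) ->
  computable (fun v => F [tuple G i v | i < m]).
Proof.
move=> [f fP] /fin_all_exists [g gP]; exists (RComp f g) => v y /=; split.
  move=> [w wP /fP->]; congr F; apply: eq_from_tnth => i.
  by rewrite tnth_mktuple; apply/gP.
move=> ->; exists [tuple G i v | i < m]; last exact/fP.
by move=> i; apply/gP; rewrite tnth_mktuple.
Qed.

Lemma computable_rec n (F : n.-tuple nat -> nat) (G : n.+2.-tuple nat -> nat) :
  computable F -> computable G ->
  computable (fun v : n.+1.-tuple nat =>
    nat_rec (fun=> nat) (F [tuple of behead v])
      (fun k r => G [tuple of k :: r :: behead v]) (thead v)).
Proof.
move=> [f fP] [g gP]; exists (RRec f g) => v /=.
elim: (thead v) => [|k IHk] y //=; split=> [[r /IHk-> /gP]|->] //.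
by eexists; [apply/IHk | apply/gP].
Qed.

Lemma computable_min n (F : n.+1.-tuple nat -> nat) (M : n.-tuple nat -> nat) :
  computable F ->
  (forall v, F [tuple of M v :: v] = 0) ->
  (forall v z, z < M v -> 0 < F [tuple of z :: v]) ->
  computable M.
Proof.
move=> [f fP] FM0 FM_gt0; exists (RMin f) => v y /=; split=> [[/fP Fy0 yP]|->].
  have [lt_My | /FM_gt0 | //] := ltngtP (M v) y; last by rewrite -Fy0.
  by have [r /fP] := yP _ lt_My; rewrite FM0.
split=> [|z /FM_gt0 Fz]; first exact/fP.
by exists (F [tuple of z :: v]).-1; apply/fP; rewrite prednK.
Qed.

Lemma prim_computable n (c : prim_scheme n) : computable (prim_eval c).
Proof.
elim: c => {n} [n||n i|m n f IHf g IHg|n f IHf g IHg].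
- exact: computable_zero.
- by exists RSucc.
- exact: computable_proj.
- exact: computable_comp.
apply: eq_computable (computable_rec IHf IHg) => v /=.
by elim: (thead v) => //= k ->.
Qed.

(* Functions of the first [n] variables, read off as entries of a sequence:
   this makes substitution of expressions computational. *)
Definition recfn n (F : seq nat -> nat) : Prop :=
  computable (fun v : n.-tuple nat => F v).

Lemma eq_recfn n F G : F =1 G -> recfn n F -> recfn n G.
Proof. by move=> eqFG; apply: eq_computable => v. Qed.

Lemma recfn_nth n i : i < n -> recfn n (nth 0 ^~ i).
Proof.
move=> lt_in; apply: eq_computable (computable_proj (Ordinal lt_in)) => v.
by rewrite (tnth_nth 0).
Qed.

Lemma recfn_comp n F (Gs : seq (seq nat -> nat)) :
  recfn (size Gs) F ->
  (forall i, i < size Gs -> recfn n (nth (fun=> 0) Gs i)) ->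
  recfn n (fun v => F [seq G v | G <- Gs]).
Proof.
move=> Frec Grec.
apply: eq_computable (computable_comp Frec (fun i => Grec i (ltn_ord i))) => v.
congr F; apply: (@eq_from_nth _ 0); first by rewrite size_tuple size_map.
move=> i; rewrite size_tuple => lt_i; rewrite (nth_map (fun=> 0)) //.
by rewrite -[i]/(nat_of_ord (Ordinal lt_i)) -tnth_nth tnth_mktuple.
Qed.

Lemma recfn_comp1 n (f : nat -> nat) G :
  recfn 1 (fun v => f (nth 0 v 0)) -> recfn n G -> recfn n (fun v => f (G v)).
Proof.
by move=> frec Grec; apply: (@recfn_comp n _ [:: G] frec); case.
Qed.

Lemma recfn_comp2 n (f : nat -> nat -> nat) G H :
  recfn 2 (fun v => f (nth 0 v 0) (nth 0 v 1)) -> recfn n G -> recfn n H ->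
  recfn n (fun v => f (G v) (H v)).
Proof.
move=> frec Grec Hrec; apply: (@recfn_comp n _ [:: G; H] frec).
by case=> [|[]].
Qed.

Lemma recfn_succ n G : recfn n G -> recfn n (fun v => (G v).+1).
Proof.
apply: recfn_comp1; exists RSucc => v y /=.
by rewrite /thead (tnth_nth 0).
Qed.

Lemma recfn_const n k : recfn n (fun=> k).
Proof.
by elim: k => [|k IHk]; [exact: computable_zero | exact: recfn_succ].
Qed.

(** Composing the recursion scheme with [K] and the [n] projections frees the iteration count from
    being the first variable. In [B], entries 0 and 1 are the counter and the previous value; those
    of [v] are shifted by two. *)
Lemma recfn_rec n A B K :
  recfn n A -> recfn n.+2 B -> recfn n K ->
  recfn n (fun v =>
    nat_rec (fun=> nat) (A v) (fun k r => B (k :: r :: v)) (K v)).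
Proof.
move=> Arec Brec Krec.
pose R (v : seq nat) := nat_rec (fun=> nat) (A (behead v))
  (fun k r => B (k :: r :: behead v)) (nth 0 v 0).
pose Gs := K :: [seq nth 0 ^~ i | i <- iota 0 n].
have szGs : size Gs = n.+1 by rewrite /= size_map size_iota.
have Rrec : recfn (size Gs) R.
  rewrite szGs; apply: eq_computable (computable_rec Arec Brec) => v.
  by rewrite /R /= /thead (tnth_nth 0).
apply: eq_computable (recfn_comp Rrec _) => [v|].
  rewrite /R /= -map_comp (_ : map _ _ = v) //.
  rewrite -[RHS](mkseq_nth 0) size_tuple; exact: eq_map.
rewrite szGs => -[|i] //= lt_in.
by rewrite (nth_map 0) ?size_iota ?nth_iota //; apply: recfn_nth.
Qed.

Lemma recfn_min n F M :
  recfn n.+1 F -> (forall v, F (M v :: v) = 0) ->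
  (forall v z, z < M v -> 0 < F (z :: v)) -> recfn n M.
Proof.
move=> Frec FM0 FM_gt0; apply: computable_min Frec _ _ => v; first exact: FM0.
exact: FM_gt0.
Qed.

(** * Recursiveness of arithmetic operations *)

Lemma recfn_add n G H :
  recfn n G -> recfn n H -> recfn n (fun v => G v + H v).
Proof.
apply: recfn_comp2.
apply: eq_recfn (@recfn_rec 2 (nth 0 ^~ 0) (fun v => (nth 0 v 1).+1)
  (nth 0 ^~ 1) _ _ _) => [v|||]; try exact: recfn_nth.
  by elim: (nth 0 v 1) => [|k /= ->]; rewrite ?addn0 ?addnS.
by apply: recfn_succ; apply: recfn_nth.
Qed.

Lemma recfn_mul n G H :
  recfn n G -> recfn n H -> recfn n (fun v => G v * H v).
Proof.
apply: recfn_comp2.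
apply: eq_recfn (@recfn_rec 2 (fun=> 0) (fun v => nth 0 v 2 + nth 0 v 1)
  (nth 0 ^~ 1) _ _ _) => [v|||]; try exact: recfn_nth.
- by elim: (nth 0 v 1) => [|k /= ->]; rewrite ?muln0 ?mulnS.
- exact: recfn_const.
by apply: recfn_add; apply: recfn_nth.
Qed.

Lemma recfn_exp n G H :
  recfn n G -> recfn n H -> recfn n (fun v => G v ^ H v).
Proof.
apply: recfn_comp2.
apply: eq_recfn (@recfn_rec 2 (fun=> 1) (fun v => nth 0 v 2 * nth 0 v 1)
  (nth 0 ^~ 1) _ _ _) => [v|||]; try exact: recfn_nth.
- by elim: (nth 0 v 1) => [|k /= ->]; rewrite ?expn0 ?expnS.
- exact: recfn_const.
by apply: recfn_mul; apply: recfn_nth.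
Qed.

Lemma recfn_pred n G : recfn n G -> recfn n (fun v => (G v).-1).
Proof.
apply: recfn_comp1.
apply: eq_recfn (@recfn_rec 1 (fun=> 0) (nth 0 ^~ 0) (nth 0 ^~ 0) _ _ _)
  => [v|||]; try exact: recfn_nth; last exact: recfn_const.
by case: (nth 0 v 0).
Qed.

Lemma recfn_sub n G H :
  recfn n G -> recfn n H -> recfn n (fun v => G v - H v).
Proof.
apply: recfn_comp2.
apply: eq_recfn (@recfn_rec 2 (nth 0 ^~ 0) (fun v => (nth 0 v 1).-1)
  (nth 0 ^~ 1) _ _ _) => [v|||]; try exact: recfn_nth.
  by elim: (nth 0 v 1) => [|k /= ->]; rewrite ?subn0 ?subnS.
by apply: recfn_pred; apply: recfn_nth.
Qed.

Lemma recfn_div n G H :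
  recfn n G -> recfn n H -> recfn n (fun v => G v %/ H v).
Proof.
apply: recfn_comp2.
(* On [[:: z; x; d]] this vanishes iff [x < z.+1 * d] or [d = 0]; the last factor accounts for the
   convention [x %/ 0 = 0]. *)
pose F v := ((nth 0 v 1).+1 - (nth 0 v 0).+1 * nth 0 v 2) * nth 0 v 2.
apply: (@recfn_min 2 F) => [|v|v z]; rewrite /F /=.
- apply: recfn_mul; last exact: recfn_nth.
  apply: recfn_sub; first by apply: recfn_succ; apply: recfn_nth.
  by apply: recfn_mul; [apply: recfn_succ|]; apply: recfn_nth.
- case: (posnP (nth 0 v 1)) => [->|d_gt0]; first by rewrite muln0.
  by apply/eqP; rewrite muln_eq0 subn_eq0 ltn_ceil.
case: (posnP (nth 0 v 1)) => [->|d_gt0]; first by rewrite divn0.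
by rewrite leq_divRL // muln_gt0 d_gt0 subn_gt0 ltnS andbT.
Qed.

Lemma recfn_mod n G H :
  recfn n G -> recfn n H -> recfn n (fun v => G v %% H v).
Proof.
move=> Grec Hrec.
apply: (@eq_recfn n (fun v => G v - G v %/ H v * H v)) => [v|].
  by rewrite {1}(divn_eq (G v) (H v)) addKn.
by apply: recfn_sub => //; apply: recfn_mul => //; apply: recfn_div.
Qed.

Lemma recfn_log2 n G : recfn n G -> recfn n (fun v => logn 2 (G v)).
Proof.
apply: recfn_comp1.
(* On [[:: z; x]] this vanishes iff [2 ^ z.+1] does not divide [x] or [x = 0]; the first factor
   matches [logn 2 0 = 0]. *)
pose F v := nth 0 v 1 * (1 - nth 0 v 1 %% 2 ^ (nth 0 v 0).+1).
apply: (@recfn_min 1 F) => [|v|v z]; rewrite /F /=.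
- apply: recfn_mul; first exact: recfn_nth.
  apply: recfn_sub; first exact: recfn_const.
  apply: recfn_mod; first exact: recfn_nth.
  apply: recfn_exp; first exact: recfn_const.
  by apply: recfn_succ; apply: recfn_nth.
- case: (posnP (nth 0 v 0)) => [->|x_gt0]; first by rewrite mul0n.
  apply/eqP; rewrite muln_eq0 subn_eq0 lt0n -/(dvdn _ _) pfactor_dvdn //.
  by rewrite ltnn orbT.
case: (posnP (nth 0 v 0)) => [->|x_gt0]; first by rewrite logn0.
by rewrite -pfactor_dvdn // muln_gt0 x_gt0 => /eqP->.
Qed.

(** * A fast-growing hierarchy *)

(* The factor [m] in the number of iterations spares the process below a case
   distinction: it is 0 exactly when nothing is to be pushed. *)
Fixpoint E m t := if m is k.+1 then iter (t.+2 * m) (E k) t.+1 else t.+1.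

Lemma ES m t : E m.+1 t = iter (t.+2 * m.+1) (E m) t.+1.
Proof. by []. Qed.

Lemma ltn_E m t : t < E m t.
Proof.
elim: m t => // m IHm t; rewrite ES; elim: (_ * _) => //= k IHk.
exact: ltn_trans IHk (IHm _).
Qed.

Lemma leq_iter_E m j k t : j <= k -> iter j (E m) t <= iter k (E m) t.
Proof.
move=> /subnK<-; elim: (k - j) => //= i IHi.
exact: leq_trans IHi (ltnW (ltn_E _ _)).
Qed.

Lemma leq_iter j f x y :
  {homo f : a b / a <= b} -> x <= y -> iter j f x <= iter j f y.
Proof. by move=> fM le_xy; elim: j => //= j; apply: fM. Qed.

Lemma leq_E2l m : {homo E m : t u / t <= u}.
Proof.
elim: m => // m IHm t u le_tu; rewrite !ES.
apply: leq_trans (leq_iter_E _ _ _); first exact: (leq_iter _ IHm).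
by rewrite leq_mul.
Qed.

(** The room up to [t.+2] serves both closure schemes: composition costs two iterations of a level,
    recursion up to [N.+1]. *)
Lemma iter_E_leq m j t : j <= t.+2 -> iter j (E m) t <= E m.+1 t.
Proof.
move=> le_jt; rewrite ES; apply: leq_trans (leq_iter_E _ _ (leq_trans le_jt _)).
  exact: leq_iter (@leq_E2l m) (leqnSn t).
exact: leq_pmulr.
Qed.

Lemma leq_E t : {homo E ^~ t : m n / m <= n}.
Proof.
move=> m n /subnK<-; elim: (n - m) => //= k IHk.
exact: leq_trans IHk (@iter_E_leq _ 1 _ _).
Qed.

(** By induction on the scheme: [E 0] bounds the initial functions, and composition and recursion
    each need one level above the maximum of their components' levels. *)
Lemma prim_eval_bound n (c : prim_scheme n) :
  exists m, forall (v : n.-tuple nat) N,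
    (forall i, tnth v i <= N) -> prim_eval c v <= E m N.
Proof.
elim: c => {n} [n||n i|m n f [a fP] g IHg|n f [a fP] g [b gP]].
- by exists 0.
- by exists 0 => v N vN /=; rewrite ltnS; apply: vN.
- by exists 0 => v N vN /=; rewrite leqW.
- have /fin_all_exists [b gP] := IHg.
  pose M := maxn a (\max_i b i).
  exists M.+1 => v N vN; apply: leq_trans (@iter_E_leq M 2 N _) => //=.
  apply: leq_trans (fP _ (E M N) _) (leq_E _ (leq_maxl _ _)) => i.
  rewrite tnth_mktuple; apply: leq_trans (gP _ _ _ vN) (leq_E _ _).
  by rewrite leq_max leq_bigmax orbT.
pose M := maxn a b.
exists M.+1 => v N vN /=.
have xN i : tnth [tuple of behead v] i <= N by rewrite tnth_behead.
apply: leq_trans (@iter_E_leq M (thead v).+1 N _); last first.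
  by rewrite ltnS leqW // vN.
have: thead v <= N by apply: vN.
elim: (thead v) => [_|k IHk lt_kN].
  exact: leq_trans (fP _ _ xN) (leq_E _ (leq_maxl _ _)).
(* The bound on the [k]-th recursion value, [iter k.+1 (E M) N], also bounds the counter and the
   parameters, so it bounds every argument of [g]. *)
apply: leq_trans (gP _ (iter k.+1 (E M) N) _) (leq_E _ (leq_maxr _ _)) => i.
have leN : N <= iter k.+1 (E M) N by apply: (@leq_iter_E M 0).
case: (unliftP ord0 i) => [j|] ->; last first.
  by rewrite tnth0; apply: leq_trans leN; apply: ltnW.
rewrite tnthS; case: (unliftP ord0 j) => [l|] ->.
  by rewrite tnthS; apply: leq_trans leN; apply: xN.
by rewrite tnth0; apply/IHk/ltnW.
Qed.

(** * The diagonal of the hierarchy is recursive *)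

(* A stack is coded by 0 when empty, and otherwise with [push]. *)
Definition push m z := 2 ^ m * z.*2.+1.

(** [logn 2 z] is the top item and the quotient is the rest of the stack. A top 0 is simply removed,
    and the empty stack stays empty. *)
Definition step t z :=
  iter (t.+2 * logn 2 z) (push (logn 2 z).-1) (z %/ 2 ^ (logn 2 z).+1).

Lemma logn_push m z : logn 2 (push m z) = m.
Proof.
rewrite /push lognM ?expn_gt0 // pfactorK // (@lognE 2 _.+1) dvdn2 /=.
by rewrite odd_double addn0.
Qed.

Lemma step_push t m z : step t (push m z) = iter (t.+2 * m) (push m.-1) z.
Proof.
rewrite /step logn_push; congr iter.
rewrite /push expnSr divnMA mulKn ?expn_gt0 // divn2.
exact: (half_bit_double z true).
Qed.

Lemma step0 t : step t 0 = 0.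
Proof. by rewrite /step logn0 muln0 div0n. Qed.

Definition tick s := (s.1.+1, step s.1 s.2).

Definition reach s s' := exists k, iter k tick s = s'.

Lemma reach_trans s1 s2 s3 : reach s1 s2 -> reach s2 s3 -> reach s1 s3.
Proof.
by move=> [j <-] [k <-]; exists (k + j); rewrite iterD.
Qed.

(** One tick turns the top [m.+1] into [t.+2 * m.+1] copies of [m] at time [t.+1]. By induction,
    removing each copy applies [E m] to the clock, which is the recursion defining [E m.+1 t]. *)
Lemma reach_push m t z : reach (t, push m z) (E m t, z).
Proof.
elim: m t z => [|m IHm] t z.
  by exists 1; rewrite /= /tick step_push muln0.
apply: (@reach_trans _ (t.+1, iter (t.+2 * m.+1) (push m) z)).
  by exists 1; rewrite /= /tick step_push.
rewrite ES; move: (_ * _) => j; elim: j (t.+1) => [|j IHj] u; first by exists 0.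
by rewrite [iter _ (E m) u]iterSr; apply: reach_trans (IHm _ _) (IHj _).
Qed.

Definition stack_at x k := (iter k tick (x, push x (push 0 0))).2.

Lemma time_at x k z : (iter k tick (x, z)).1 = x + k.
Proof. by elim: k => [|k /= ->]; rewrite ?addn0 ?addnS. Qed.

Lemma stack_atS x k : stack_at x k.+1 = step (x + k) (stack_at x k).
Proof. by rewrite /stack_at /= time_at. Qed.

(* The extra item 0 at the bottom makes the stack become empty exactly one
   unit of time after [E x x]. *)
Lemma stack_at_E x : stack_at x (E x x - x) = push 0 0.
Proof.
have [k kP] := reach_push x x (push 0 0).
have Ex : E x x = x + k by rewrite -(time_at x k (push x (push 0 0))) kP.
by rewrite /stack_at Ex addKn kP.
Qed.

(** Emptiness persists by [step0], so the stack cannot be empty while [push 0 0] is still to come,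
    and it stays empty from the next tick on. *)
Lemma stack_at_eq0 x k : (stack_at x k == 0) = (E x x < x + k).
Proof.
have Ex := subnKC (ltnW (ltn_E x x)).
have [lt_Ek | le_kE] := ltnP.
  have [j ->] : exists j, k = j + (E x x - x).+1.
    by exists (k - (E x x - x).+1); rewrite subnK // -(ltn_add2l x) Ex.
  elim: j => [|j IHj]; last by rewrite addSn stack_atS (eqP IHj) step0.
  by rewrite stack_atS stack_at_E step_push muln0.
have [j eqE] : exists j, E x x - x = j + k.
  by exists (E x x - x - k); rewrite subnK // -(leq_add2l x) Ex.
apply/eqP => zk0; have := stack_at_E x; rewrite eqE.
suff -> : stack_at x (j + k) = 0 by [].
by elim: j {eqE} => // j IHj; rewrite addSn stack_atS IHj step0.
Qed.

Lemma recfn_push n G H :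
  recfn n G -> recfn n H -> recfn n (fun v => push (G v) (H v)).
Proof.
move=> Grec Hrec.
apply: (@eq_recfn n (fun v => 2 ^ G v * (H v + H v).+1)) => [v|].
  by rewrite /push addnn.
apply: recfn_mul; first by apply: recfn_exp => //; apply: recfn_const.
by apply: recfn_succ; apply: recfn_add.
Qed.

Lemma recfn_step n G H :
  recfn n G -> recfn n H -> recfn n (fun v => step (G v) (H v)).
Proof.
apply: recfn_comp2.
pose A v := nth 0 v 1 %/ 2 ^ (logn 2 (nth 0 v 1)).+1.
pose B v := push (logn 2 (nth 0 v 3)).-1 (nth 0 v 1).
pose K v := (nth 0 v 0).+2 * logn 2 (nth 0 v 1).
apply: eq_recfn (@recfn_rec 2 A B K _ _ _) => [v|||].
- by rewrite /step -/(K v); elim: (K v) => //= k ->.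
- apply: recfn_div; first exact: recfn_nth.
  apply: recfn_exp; first exact: recfn_const.
  by apply: recfn_succ; apply: recfn_log2; apply: recfn_nth.
- apply: recfn_push; last exact: recfn_nth.
  by apply: recfn_pred; apply: recfn_log2; apply: recfn_nth.
apply: recfn_mul; last by apply: recfn_log2; apply: recfn_nth.
by do 2 apply: recfn_succ; apply: recfn_nth.
Qed.

Lemma recfn_diag n G : recfn n G -> recfn n (fun v => E (G v) (G v)).
Proof.
apply: (recfn_comp1 (f := fun x => E x x)).
(* The number of ticks until the stack started at time [x] is empty; adding [x] and taking the
   predecessor recovers [E x x]. *)
pose M v := (E (nth 0 v 0) (nth 0 v 0)).+1 - nth 0 v 0.
suff Mrec : recfn 1 M.
  apply: (@eq_recfn 1 (fun v => (nth 0 v 0 + M v).-1)) => [v|].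
    by rewrite subnKC // leqW // ltnW // ltn_E.
  by apply: recfn_pred; apply: recfn_add => //; apply: recfn_nth.
have le_xE v := leqW (ltnW (ltn_E (nth 0 v 0) (nth 0 v 0))).
apply: (@recfn_min 1 (fun v => stack_at (nth 0 v 1) (nth 0 v 0))) => [|v|v z].
- pose A v := push (nth 0 v 1) (push 0 0).
  pose B v := step (nth 0 v 3 + nth 0 v 0) (nth 0 v 1).
  apply: eq_recfn (@recfn_rec 2 A B (nth 0 ^~ 0) _ _ _) => [v|||].
  + by elim: (nth 0 v 0) => //= k IHk; rewrite stack_atS -IHk.
  + by apply: recfn_push; [apply: recfn_nth | apply: recfn_const].
  + apply: recfn_step; last exact: recfn_nth.
    by apply: recfn_add; apply: recfn_nth.
  exact: recfn_nth.
- by apply/eqP; rewrite /= stack_at_eq0 subnKC.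
rewrite /M /= lt0n stack_at_eq0 -leqNgt.
by rewrite -(ltn_add2l (nth 0 v 0)) subnKC.
Qed.

(** * The separation *)

Lemma total_recursiveP h :
  total_recursive h <-> recfn 1 (fun v => h (nth 0 v 0)).
Proof.
split=> -[c cP]; exists c; last by move=> x y; apply: cP.
move=> v y; have -> : v = [tuple nth 0 v 0]; last exact: cP.
by apply: eq_from_tnth => i; rewrite ord1 (tnth_nth 0).
Qed.

Lemma primitive_recursive_total h : primitive_recursive h -> total_recursive h.
Proof.
move=> [c cP]; have [d dP] := prim_computable c.
by exists d => x y; rewrite -cP; apply: dP.
Qed.

Lemma primitive_recursive_comp f g :
  primitive_recursive f -> primitive_recursive g ->
  primitive_recursive (f \o g).
Proof.
move=> [c cP] [d dP]; exists (PComp c (fun=> d)) => x /=; rewrite -cP.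
congr prim_eval; apply: eq_from_tnth => i.
by rewrite tnth_mktuple dP ord1.
Qed.

Fixpoint prim_const n k : prim_scheme n :=
  if k is k'.+1 then PComp PSucc (fun=> prim_const n k') else PZero n.

Lemma prim_constE n k v : prim_eval (prim_const n k) v = k.
Proof. by elim: k => //= k IHk; rewrite /thead tnth_mktuple IHk. Qed.

Lemma primitive_recursive_iter f r h :
  primitive_recursive f -> h 0 = r -> (forall n, h n.+1 = f (h n)) ->
  primitive_recursive h.
Proof.
move=> [c cP] h0 hS.
(* Recursion without parameters; the projection at index 1 passes the previous value to [c] and
   drops the counter. *)
exists (PRec (prim_const 0 r) (PComp c (fun=> PProj (lift ord0 ord0)))) => x.
rewrite /prim_eval -/prim_eval theadE; move: [tuple of behead _] => u.
elim: x => [|x IHx].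
  by rewrite h0 prim_constE.
rewrite hS -cP -IHx; congr prim_eval.
by apply: eq_from_tnth => i; rewrite tnth_mktuple (ord1 i) !(tnth_nth 0).
Qed.

Lemma primitive_recursive_bound h :
  primitive_recursive h -> exists m, forall x, h x <= E m x.
Proof.
move=> [c cP]; have [m mP] := prim_eval_bound c; exists m => x; rewrite -cP.
by apply: mP => i; rewrite ord1.
Qed.

(** Pigeonhole: otherwise [rho] would inject [N.+1] arguments into [N] values. *)
Lemma injective_unbounded (rho : nat -> nat) N :
  injective rho -> exists y, N <= rho y.
Proof.
move=> rho_inj.
have [/existsP[y]|] := boolP [exists y : 'I_N.+1, N <= rho y].
  by exists y.
rewrite negb_exists => /forallP rhoN.
have lt_rhoN y : rho (y : 'I_N.+1) < N by rewrite ltnNge.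
have /leq_card : injective (fun y => Ordinal (lt_rhoN y)).
  by move=> y z [/rho_inj/val_inj].
by rewrite !card_ord ltnn.
Qed.

Lemma total_recursive_inverse_bound (rho : nat -> nat) A :
  injective rho -> total_recursive rho -> total_recursive A ->
  exists2 g, total_recursive g & forall x, A x <= rho (g x).
Proof.
move=> rho_inj /total_recursiveP rho_rec /total_recursiveP A_rec.
pose g x := ex_minn (injective_unbounded (A x) rho_inj).
exists g => [|x]; last by rewrite /g; case: ex_minnP.
apply/total_recursiveP.
pose F v := A (nth 0 v 1) - rho (nth 0 v 0).
apply: (@recfn_min 1 F) => [|v|v z]; rewrite /F /=.
- apply: recfn_sub.
    by apply: recfn_comp1 A_rec _; apply: recfn_nth.
  by apply: recfn_comp1 rho_rec _; apply: recfn_nth.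
- by apply/eqP; rewrite subn_eq0 /g; case: ex_minnP.
rewrite subn_gt0 /g; case: ex_minnP => y _ min_y lt_zy.
by rewrite ltnNge; apply: contraL lt_zy => /min_y; rewrite -leqNgt.
Qed.

Lemma Prim_simulates_Rec_lift rho g :
  simulates_via Prim rho Rec -> total_recursive g ->
  exists2 f, primitive_recursive f & forall x, rho (g x) = f (rho x).
Proof.
move=> sim grec.
have [|f [h hprim fE] fP] := sim (fun x => Some (g x)); first by exists g.
by exists h => // x; have := fP x; rewrite fE => -[].
Qed.

Theorem mainTheorem1 : strictly_simulates Rec Prim.
Proof.
split.
  exists id => // f [h /primitive_recursive_total hrec fE].
  by exists f; [exists h | move=> x; rewrite fE].
move=> [rho rho_inj sim].
have [|f0 f0_prim rhoS] := Prim_simulates_Rec_lift (g := succn) sim.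
  by apply/total_recursiveP; apply: recfn_succ; apply: recfn_nth.
have rho_prim : primitive_recursive rho.
  exact: primitive_recursive_iter f0_prim erefl rhoS.
have A_rec : total_recursive (fun x => (E x x).+1).
  by apply/total_recursiveP/recfn_succ/recfn_diag/recfn_nth.
have [g g_rec gP] := total_recursive_inverse_bound rho_inj
  (primitive_recursive_total rho_prim) A_rec.
have [f f_prim fP] := Prim_simulates_Rec_lift sim g_rec.
have [m mP] :=
  primitive_recursive_bound (primitive_recursive_comp f_prim rho_prim).
(* Diagonalization at [x = m]: [(E m m).+1 <= rho (g m) = f (rho m) <= E m m]. *)
by have := leq_trans (gP m) (eq_leq (fP m)); rewrite ltnNge (mP m).
Qed.
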